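(* Let $H_1,H_2,V_1,V_2$ be complex Hilbert spaces with $V_k$ densely (and continuously) embedded in $H_k$ for $k\in\{1,2\}$. For $k\in\{1,2\}$ let $a_k\colon V_k\times V_k\to\mathbb{C}$ be a continuous elliptic sesquilinear form, let $A_k$ be the operator in $H_k$ associated with $a_k$, and let $S^k=(S^k_t)_{t>0}$ be the semigroup on $H_k$ generated by $-A_k$. Let $\Phi\in\mathcal{L}(H_1,H_2)$. Consider the following conditions. (i) $S^2_t\,\Phi=\Phi\,S^1_t$ for all $t>0$. (ii) $\Phi(D(A_1))\subset D(A_2)$ and $A_2\,\Phi u=\Phi\,A_1u$ for all $u\in D(A_1)$. (iii) $\Phi(V_1)\subset V_2$, $\Phi^*(V_2)\subset V_1$ and $a_2(\Phi u,v)=a_1(u,\Phi^*v)$ for all $u\in V_1$ and $v\in V_2$. Then (i) and (ii) are equivalent, and (iii) implies (i) and (ii).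
   Context: A continuous sesquilinear form $a\colon V\times V\to\mathbb{C}$, where $V$ is densely embedded in the Hilbert space $H$, is called elliptic if there exist $\omega\in\mathbb{R}$ and $\mu>0$ such that $\operatorname{Re}a(u,u)+\omega\|u\|_H^2\ge\mu\|u\|_V^2$ for all $u\in V$. The operator $A$ in $H$ associated with $a$ has domain $D(A)=\{u\in V:\text{there is an } f\in H \text{ with } a(u,v)=(f,v)_H\text{ for all }v\in V\}$, and $Au=f$ for such $u,f$. Then $-A$ generates a holomorphic $C_0$-semigroup on $H$. No self-adjointness or compactness of resolvents is assumed. $\mathcal{L}(H_1,H_2)$ denotes the bounded linear operators from $H_1$ to $H_2$, and $\Phi^*\in\mathcal{L}(H_2,H_1)$ is the Hilbert space adjoint. *)

(* Defs.v *)
From HB Require Import structures.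
From mathcomp Require Import all_boot all_order all_algebra.
From mathcomp Require Import complex.
From mathcomp Require Import all_classical all_reals all_analysis.

Set Implicit Arguments.
Unset Strict Implicit.
Unset Printing Implicit Defensive.

Import Order.TTheory GRing.Theory Num.Theory.
Import numFieldNormedType.Exports.

Local Open Scope classical_set_scope.
Local Open Scope ring_scope.
Local Open Scope complex_scope.

(* Complex Hilbert spaces. As everywhere below, forms are linear in the first
   argument and conjugate-linear in the second. *)
HB.mixin Record CompleteNormedModule_isHilbert (R : realType) H
    of CompleteNormedModule R[i] H := {
  hdot : {dot H for @Num.conj R[i]} ;
  hdot_norm : forall u : H, `|u| ^+ 2 = hdot u u }.

#[short(type="hilbertType")]
HB.structure Definition Hilbert (R : realType) :=
  {H of CompleteNormedModule R[i] H & CompleteNormedModule_isHilbert R H}.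

Notation "'[ u , v ]_H" := (hdot u v)
  (at level 0, format "''[' u ,  v ]_H") : ring_scope.

Notation "{ 'sesqui' V }" :=
  {bilinear V -> V -> _ | *%R & (@Num.conj _) \; *%R}
  (at level 0, format "{ 'sesqui'  V }") : ring_scope.

Section HilbertDefs.
Context {R : realType}.
Implicit Types H V : hilbertType R.

Record dense_embedding V H (j : {linear V -> H}) : Prop := DenseEmbedding {
  dense_embedding_continuous : continuous j ;
  dense_embedding_inj : injective j ;
  dense_embedding_dense : dense (range j) }.

(* By the Riesz representation theorem, the set below is a singleton for every
   v as soon as Phi is bounded. *)
Definition adjoint H1 H2 (Phi : {linear H1 -> H2}) (v : H2) : H1 :=
  xget 0 [set w | forall u, '[Phi u, v]_H = '[u, w]_H].

Section Forms.
Context {V H} (j : {linear V -> H}) (a : {sesqui V}).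

Definition form_continuous := continuous (fun p : V * V => a p.1 p.2 : R[i]^o).

(* Both sides are real elements of R[i]. *)
Definition elliptic := exists omega mu : R, 0 < mu /\ forall u : V,
  mu%:C * `|u| ^+ 2 <= 'Re (a u u) + omega%:C * `|j u| ^+ 2.

Definition form_graph (u f : H) : Prop :=
  exists2 w : V, j w = u & forall v : V, a w v = '[f, j v]_H.

Definition form_dom : set H := [set u | exists f, form_graph u f].

(* Meaningful on form_dom only, where density of the range of j (and
   injectivity of j) makes the value unique. *)
Definition form_op (u : H) : H := xget 0 (form_graph u).

End Forms.

Section Semigroups.
Context {H}.

(* Only the operators S t with 0 < t are relevant. *)
Record C0_semigroup (S : R -> {linear H -> H}) : Prop := C0Semigroup {
  C0_semigroup_bounded : forall t, 0 < t -> continuous (S t) ;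
  C0_semigroupD : forall s t, 0 < s -> 0 < t ->
    forall u, S (s + t) u = S s (S t u) ;
  C0_semigroup_cvg : forall u, S t u @[t --> 0^'+] --> u }.

Definition generator_quotient (S : R -> {linear H -> H}) (u : H) (t : R) : H :=
  (t^-1)%:C *: (S t u - u).

(* The operator B with domain D is the generator of S (values of B outside D
   are irrelevant). *)
Record generates (D : set H) (B : H -> H) (S : R -> {linear H -> H}) : Prop :=
  Generates {
    generates_C0 : C0_semigroup S ;
    generates_dom : D = [set u | cvg (generator_quotient S u @ 0^'+)] ;
    generates_cvg : forall u, D u -> generator_quotient S u @ 0^'+ --> B u }.

End Semigroups.
End HilbertDefs.

(* Main.v *)
(* If (i) holds, applying Phi to the difference quotients of S^1 gives those of
   S^2, whence (ii).  If (iii) holds, testing a_1(w, .) = (f, .) against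
   Phi^* v turns the graph of A_1 into the graph of A_2.  For (ii) => (i), let u
   be in D(A_1) and y(t) = S^2_t Phi u - Phi S^1_t u: then y' = - A_2 y and
   y(0) = 0, while Re (A_2 y, y) >= - omega |y|^2 by ellipticity, so y = 0 by
   Gronwall; the general case follows since D(A_1) is dense by Lax-Milgram.
   Only the right derivative of |y|^2 is used, and the left continuity of y that
   this requires comes from the uniform boundedness principle.  Norms are handled
   as real numbers, and the passage from real to complex inner products is made
   by testing against multiples by complex scalars. *)
Require Import Defs.
From HB Require Import structures.
From mathcomp Require Import all_boot all_order all_algebra.
From mathcomp Require Import complex.
From mathcomp Require Import all_classical all_reals all_analysis.
From mathcomp Require Import ring lra.

Set Implicit Arguments.
Unset Strict Implicit.
Unset Printing Implicit Defensive.

Import Order.TTheory GRing.Theory Num.Theory.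
Import numFieldNormedType.Exports.
Local Open Scope classical_set_scope.
Local Open Scope ring_scope.

(** * Real-valued norm and inner product *)

Section RealNorm.
Context {R : realType}.
Implicit Types (V W : normedModType R[i]).

(** Norms take values in [R[i]], where they are nonnegative reals. The real part thus loses nothing
    and lands in a totally ordered field where [lra] and [nra] apply. *)
Definition rnorm V (u : V) : R := complex.Re `|u|.

Lemma rnormE V (u : V) : ((rnorm u)%:C)%C = `|u|.
Proof. by rewrite RRe_real// normr_real. Qed.

Lemma rnorm_ge0 V (u : V) : 0 <= rnorm u.
Proof. by rewrite -(@ler0c R) rnormE. Qed.

Lemma rnorm0 V : rnorm (0 : V) = 0.
Proof. by rewrite /rnorm normr0. Qed.

Lemma rnormN V (u : V) : rnorm (- u) = rnorm u.
Proof. by rewrite /rnorm normrN. Qed.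

Lemma rnormBC V (u v : V) : rnorm (u - v) = rnorm (v - u).
Proof. by rewrite /rnorm distrC. Qed.

Lemma ler_rnormD V (u v : V) : rnorm (u + v) <= rnorm u + rnorm v.
Proof. by rewrite -lecR rmorphD/= !rnormE ler_normD. Qed.

Lemma ler_rnormB V (u v : V) : rnorm (u - v) <= rnorm u + rnorm v.
Proof. by rewrite (le_trans (ler_rnormD _ _))// rnormN. Qed.

Lemma ler_rdistD V (w u v : V) : rnorm (u - v) <= rnorm (u - w) + rnorm (w - v).
Proof. by have := ler_rnormD (u - w) (w - v); rewrite subrKA. Qed.

Lemma rnormZ V (c : R[i]) (u : V) : rnorm (c *: u) = complex.Re `|c| * rnorm u.
Proof.
apply: (@complexI R); rewrite (rnormE (c *: u)) normrZ -rnormE -(RRe_real (normr_real c)).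
by rewrite -(rmorphM (real_complex R)).
Qed.

Lemma normc_real (r : R) : `|(r%:C)%C| = (`|r|%:C)%C :> R[i].
Proof. by rewrite normc_def/= expr0n/= addr0 sqrtr_sqr. Qed.

Lemma rnormZr V (r : R) (u : V) : rnorm ((r%:C)%C *: u) = `|r| * rnorm u.
Proof. by rewrite rnormZ normc_real. Qed.

Lemma rnorm_eq0 V (u : V) : rnorm u = 0 -> u = 0.
Proof. by move=> u0; apply/eqP; rewrite -normr_eq0 -rnormE u0. Qed.

Lemma rnorm_small V (u : V) : (forall e : R, 0 < e -> rnorm u < e) -> u = 0.
Proof.
move=> ue; apply/rnorm_eq0/eqP; rewrite eq_le rnorm_ge0 andbT.
by apply/ler_addgt0Pl => e e0; rewrite addr0 ltW// ue.
Qed.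

Lemma cvg_rnormP V T (F : set_system T) {FF : Filter F} (f : T -> V) (l : V) :
  (f x @[x --> F] --> l) <->
  (forall e : R, 0 < e -> \forall x \near F, rnorm (f x - l) < e).
Proof.
split=> [/cvgrPdist_lt fl e e0|fl].
  have := fl (e%:C)%C; rewrite ltcR => /(_ e0).
  by apply: filterS => x; rewrite -rnormE ltcR rnormBC.
(* In [R[i]] positivity forces the imaginary part to vanish, so only real radii occur. *)
apply/cvgrPdist_lt => -[e i] /=; rewrite ltcE/= => /andP[/eqP-> e0].
by apply: filterS (fl _ e0) => x; rewrite -rnormE ltcR rnormBC.
Qed.

Lemma cvg_seq_rnorm (V : completeNormedModType R[i]) (x : nat -> V) :
  (forall e : R, 0 < e -> exists N, forall n, (N <= n)%N -> rnorm (x N - x n) < e) ->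
  exists l, forall e : R, 0 < e -> exists N, forall n, (N <= n)%N ->
    rnorm (x n - l) < e.
Proof.
move=> xc.
have : cvg (x @ \oo).
  apply/cauchy_cvgP/cauchy_exP => -[e i] /=; rewrite ltcE/= => /andP[/eqP-> e0].
  have [N xN] := xc _ e0; exists (x N); exists N => // n /= /xN.
  by rewrite -ball_normE /ball_/= -rnormE ltcR.
move=> /cvg_ex[l /cvg_rnormP xl]; exists l => e /xl [N _ Nl].
by exists N => n Nn; apply: Nl.
Qed.

Lemma closure_rnormP V (A : set V) (u : V) :
  closure A u <-> (forall e : R, 0 < e -> exists2 v, A v & rnorm (v - u) < e).
Proof.
split=> [Au e e0|Au B].
  have /Au[v [Av]] : nbhs u (ball u (e%:C)%C) by apply: nbhsx_ballx; rewrite ltcR.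
  by rewrite -ball_normE /ball_/= -rnormE ltcR rnormBC => uv; exists v.
move=> /nbhs_normP[[e i] /=]; rewrite ltcE/= => /andP[/eqP-> e0] uB.
have [v Av vu] := Au _ e0; exists v; split=> //; apply: uB.
by rewrite /ball_/= -rnormE ltcR rnormBC.
Qed.

(** A strictly positive constant is provided so that later estimates can divide by it. *)
Lemma continuous_rnorm_bounded V W (f : {linear V -> W}) : continuous f ->
  exists2 M : R, 0 < M & forall u, rnorm (f u) <= M * rnorm u.
Proof.
move=> /(_ 0) /continuous_linear_bounded => /(_ 0) /linear_boundedP.
move=> /pinfty_ex_gt0 [[M i]]; rewrite ltcE/= => /andP[/eqP-> M0] fM.
exists M => // u; have := fM u.
by rewrite -!rnormE -(rmorphM (real_complex R)) lecR.
Qed.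

End RealNorm.

Section RealDot.
Context {R : realType} {H : hilbertType R}.
Implicit Types u v w : H.

Definition rdot u v : R := complex.Re '[u, v]_H.

Lemma rdotDl u v w : rdot (u + v) w = rdot u w + rdot v w.
Proof. by rewrite /rdot linearDl raddfD. Qed.

Lemma rdotNl u v : rdot (- u) v = - rdot u v.
Proof. by rewrite /rdot linearNl raddfN. Qed.

Lemma rdotC u v : rdot u v = rdot v u.
Proof.
rewrite /rdot hermC/= expr0 mul1r.
apply: (@complexI R); rewrite !complexRe; exact: Re_conj.
Qed.

Lemma rdotNr u v : rdot u (- v) = - rdot u v.
Proof. by rewrite rdotC rdotNl rdotC. Qed.

Lemma rdotZl (r : R) u v : rdot ((r%:C)%C *: u) v = r * rdot u v.
Proof.
rewrite /rdot linearZl_LR/=; case: ('[u, v]_H) => a b /=; by rewrite mul0r subr0.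
Qed.

Lemma rnorm_sqr u : rnorm u ^+ 2 = rdot u u.
Proof.
by apply: (@complexI R); rewrite rmorphXn/= rnormE /rdot -hdot_norm RRe_real//
  realX// normr_real.
Qed.

Lemma rnormD_sqr u v : rnorm (u + v) ^+ 2 = rnorm u ^+ 2 + 2 * rdot u v + rnorm v ^+ 2.
Proof.
by rewrite !rnorm_sqr rdotDl !(rdotC _ (u + v)) !rdotDl (rdotC v u); ring.
Qed.

Lemma rnormB_sqr u v : rnorm (u - v) ^+ 2 = rnorm u ^+ 2 - 2 * rdot u v + rnorm v ^+ 2.
Proof. by rewrite rnormD_sqr rdotNr rnormN mulrN. Qed.

(** Cauchy-Schwarz is read off from the triangle inequality: after squaring, only the cross term
    remains. *)
Lemma rdot_le u v : rdot u v <= rnorm u * rnorm v.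
Proof.
have := ler_rnormD u v; rewrite -(@ler_pXn2r _ 2)// ?nnegrE ?addr_ge0 ?rnorm_ge0//.
by rewrite rnormD_sqr sqrrD; lra.
Qed.

End RealDot.

(** * Orthogonal projection, Riesz representation and Lax-Milgram *)

Section Projection.
Context {R : realType} {H : hilbertType R}.
Implicit Types (M : set H) (x u v w : H).

(** A minimizing sequence for the distance from [x] to [M] is Cauchy, and its limit is [p]. As [M]
    need not be closed, [p] is only found in the closure. *)
Lemma orthogonal_projection M x : M 0 ->
  (forall (c : R[i]) u v, M u -> M v -> M (c *: u + v)) ->
  exists2 p, closure M p & forall m, M m -> '[x - p, m]_H = 0.
Proof.
move=> M0 MD.
pose E := [set rnorm (x - m) ^+ 2 | m in M]; pose d := inf E.
have E0 : has_inf E.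
  by split; [exists (rnorm (x - 0) ^+ 2), 0 | exists 0 => _ [m _ <-]; rewrite sqr_ge0].
have dle m : M m -> d <= rnorm (x - m) ^+ 2.
  by move=> Mm; apply: ge_inf; [case: E0|exists m].
have near_d (e : R) : 0 < e -> exists m, M m /\ rnorm (x - m) ^+ 2 < d + e.
  by move=> e0; have [_ [m Mm <-] me] := inf_adherent e0 E0; exists m.
(* Parallelogram law: the midpoint of [m] and [m'] is in [M], hence at squared distance at least [d]
   from [x], and 4 (d + e) - 4 d = 4 e. *)
have near_d_cauchy m m' (e : R) : M m -> M m' -> rnorm (x - m) ^+ 2 < d + e ->
    rnorm (x - m') ^+ 2 < d + e -> rnorm (m - m') ^+ 2 < 4 * e.
  move=> Mm Mm' me m'e.
  have /dle := MD ((2^-1)%:C)%C _ _ (MD 1 _ _ Mm Mm') M0.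
  have -> : m - m' = (x - m') - (x - m) by rewrite opprB [RHS]addrC subrKA.
  have -> : x - ((2^-1)%:C%C *: (1 *: m + m') + 0) =
      (2^-1)%:C%C *: ((x - m) + (x - m')).
    have {1}<- : (2^-1)%:C%C *: (x + x) = x.
      rewrite -mulr2n -(scaler_nat 2 x) scalerA.
      by rewrite -(rmorph_nat (real_complex R)) -rmorphM/= mulVf ?pnatr_eq0// scale1r.
    by rewrite addr0 scale1r -scalerBr opprD addrACA.
  move: me m'e; move: (x - m) (x - m') => a b.
  rewrite rnormZr exprMn ger0_norm ?invr_ge0//.
  by rewrite rnormB_sqr rnormD_sqr rdotC; lra.
have inv_lt (e : R) : 0 < e -> exists n : nat, n.+1%:R^-1 < e.
  move=> e0; have [n _ /(_ n (leqnn n))] := near_infty_natSinv_lt (PosNum e0).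
  by exists n.
have inv_le (n N : nat) : (N <= n)%N -> n.+1%:R^-1 <= N.+1%:R^-1 :> R.
  by move=> Nn; rewrite lef_pV2 ?posrE// ler_nat.
have [m mP] := choice (fun n : nat => near_d n.+1%:R^-1 ltac:(by rewrite invr_gt0)).
have [e e0|l ml] := @cvg_seq_rnorm R H m.
  have [N Ne] := inv_lt (e ^+ 2 / 4) ltac:(by rewrite divr_gt0// exprn_gt0).
  exists N => n Nn; rewrite -(@ltr_pXn2r _ 2)// ?nnegrE ?rnorm_ge0 ?(ltW e0)//.
  have := @near_d_cauchy (m N) (m n) N.+1%:R^-1.
  move/(_ (mP _).1 (mP _).1 (mP _).2); have := (mP n).2; have := inv_le _ _ Nn.
  move=> h1 h2 h3; have {h3} : rnorm (m N - m n) ^+ 2 < 4 * N.+1%:R^-1.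
    by apply: h3; apply: lt_le_trans h2 _; rewrite lerD2l.
  by move: Ne; move: (N.+1%:R^-1) => k; lra.
(* The limit [l] may lie outside [M], so the variational argument runs on nearly minimal points [y]
   of [M] close to [l]. *)
have mlP (e : R) : 0 < e ->
    exists y, [/\ M y, rnorm (y - l) < e & rnorm (x - y) ^+ 2 < d + e].
  move=> e0; have [N Ne] := ml _ e0; have [n ne] := inv_lt _ e0.
  exists (m (maxn N n)); split; [exact: (mP _).1|exact/Ne/leq_maxl|].
  apply: lt_le_trans (mP _).2 _; rewrite lerD2l (le_trans _ (ltW ne))//.
  exact/inv_le/leq_maxr.
exists l; first by apply/closure_rnormP => e /mlP[y [My ye _]]; exists y.
have rorth z : M z -> rdot (x - l) z = 0.
  move=> Mz; set r := rdot _ _; set s := rnorm z ^+ 2.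
  (* Compare [d] with the squared distance from [x] to [t z + y]. The constant [C] makes the two
     errors, from near minimality of [y] and from replacing [l] by [y], add up to [e]. *)
  have quad t : 0 <= t ^+ 2 * s - 2 * t * r.
    apply/ler_addgt0Pl => e e0.
    pose C := 1 + 2 * `|t| * rnorm z.
    have C0 : 0 < C by rewrite ltr_pwDl ?mulr_ge0 ?rnorm_ge0.
    have [y [My yl xy]] := mlP (e / C) (divr_gt0 e0 C0).
    have /dle := MD (t%:C)%C _ _ Mz My.
    rewrite opprD addrCA addrC rnormB_sqr rnormZr exprMn real_normK ?num_real//.
    rewrite [rdot _ _]rdotC rdotZl rdotC -[x - y](subrKA l) rdotDl -/r -/s.
    have : `|t * rdot (l - y) z| <= `|t| * (e / C * rnorm z).
      rewrite normrM ler_wpM2l// ler_norml; apply/andP; split.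
        rewrite lerNl -rdotNl (le_trans (rdot_le _ _))// rnormN ler_wpM2r ?rnorm_ge0//.
        by rewrite rnormBC ltW.
      rewrite (le_trans (rdot_le _ _))// ler_wpM2r ?rnorm_ge0//.
      by rewrite rnormBC ltW.
    have : e = e / C + 2 * (`|t| * (e / C * rnorm z)).
      by rewrite -{1}[e](divfK (lt0r_neq0 C0)) {2}/C; ring.
    rewrite ler_norml => eE /andP[h1 h2]; move: xy; rewrite -[x - y](subrKA l) => xy.
    move: eE h1 h2; set q := _ * (_ / _ * _); set q' := e / C; move: xy; rewrite -/q'; lra.
  have s0 : 0 <= s by rewrite sqr_ge0.
  (* The optimal [t] would be [r / s]; the shift by 1 covers [z = 0] and still gives a negative
     multiple of a square. *)
  have := quad (r / (s + 1)).
  have -> : (r / (s + 1)) ^+ 2 * s - 2 * (r / (s + 1)) * r =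
      - ((r / (s + 1)) ^+ 2 * (s + 2)) by field; lra.
  rewrite oppr_ge0 pmulr_lle0; last by lra.
  move=> rs0; have /eqP : (r / (s + 1)) ^+ 2 = 0.
    by apply/eqP; rewrite eq_le rs0 sqr_ge0.
  rewrite sqrf_eq0 mulf_eq0 invr_eq0 => /orP[/eqP//|/eqP]; lra.
(* Real orthogonality to [z] and to [i z] kills the real and the imaginary part. *)
move=> z Mz; have := rorth _ Mz; have := rorth _ (MD 'i%C _ _ Mz M0).
rewrite addr0 /rdot linearZr_LR/=; case: ('[x - l, z]_H) => a b /=.
by rewrite mul0r mulN1r opprK add0r => -> ->.
Qed.

End Projection.

Section Forms.
Context {R : realType}.
Implicit Types (H V : hilbertType R).

Lemma Re_le_normc (z : R[i]) : complex.Re z <= complex.Re `|z|.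
Proof.
rewrite normc_def/= (le_trans (ler_norm _))// -sqrtr_sqr ler_wsqrtr//.
by rewrite lerDl sqr_ge0.
Qed.

(** The product is |z|^2. A one-sided bound on real parts, taken at a suitable complex multiple of
    the argument, thus forces a complex number to vanish. *)
Lemma Re_mulcJ_le0 (z : R[i]) : complex.Re (Num.conj z * z) <= 0 -> z = 0.
Proof.
case: z => a b; rewrite /Num.conj/= => h.
have h2 : a ^+ 2 + b ^+ 2 <= 0 by move: h; rewrite !expr2; lra.
have a0 : a = 0 by apply/eqP; rewrite -sqrf_eq0 eq_le sqr_ge0 andbT; have := sqr_ge0 b; lra.
have b0 : b = 0 by apply/eqP; rewrite -sqrf_eq0 eq_le sqr_ge0 andbT; have := sqr_ge0 a; lra.
by rewrite a0 b0.
Qed.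

(** For [u] in [A] near [f], |f|^2 = Re (f, f - u) <= |f| |f - u|. *)
Lemma closure_orthogonal0 H (A : set H) (f : H) : closure A f ->
  (forall u, A u -> '[f, u]_H = 0) -> f = 0.
Proof.
move=> /closure_rnormP Af fA; apply: rnorm_small => e /Af[u Au uf].
case: (ltP 0 (rnorm f)) => [f0|/le_lt_trans->//]; last by rewrite (le_lt_trans (rnorm_ge0 _) uf).
rewrite (le_lt_trans _ uf)// -(ler_pM2l f0) -expr2 rnorm_sqr.
rewrite (_ : rdot f f = rdot f (f - u)); first by rewrite (rnormBC u) rdot_le.
by rewrite [RHS]rdotC rdotDl rdotNl (rdotC u) [rdot f u]/rdot fA// subr0.
Qed.

(** The representing vector is a multiple of [x - p], the normal to the kernel of [phi]. Boundedness
    is asked in one-sided form because that is what the applications supply; it suffices by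
    linearity. *)
Lemma riesz H (phi : H -> R[i]) (C : R) :
  (forall c u v, phi (c *: u + v) = c * phi u + phi v) ->
  (forall u, complex.Re (phi u) <= C * rnorm u) ->
  exists w, forall u, phi u = '[u, w]_H.
Proof.
move=> phiL phiC.
have phi0 : phi 0 = 0 by have := phiL (-1) 0 0; rewrite scaler0 addr0 mulN1r addNr.
have phiB u v : phi (u - v) = phi u - phi v.
  by rewrite addrC -scaleN1r phiL mulN1r addrC.
have phiZ c u : phi (c *: u) = c * phi u by rewrite -[c *: u]addr0 phiL phi0 addr0.
have [[x phix]|phi_eq0] := pselect (exists x, phi x != 0); last first.
  exists 0 => u; rewrite linear0r; apply/eqP/negPn/negP => phiu.
  by apply: phi_eq0; exists u.
have [|c u v /= u0 v0|p Mp xp] := @orthogonal_projection R H [set u | phi u = 0] x.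
- exact: phi0.
- by rewrite phiL u0 v0 mulr0 addr0.
(* The projection [p] is only in the closure of the kernel; the bound on [phi] shows that the kernel
   is closed. *)
have phip : phi p = 0.
  apply: Re_mulcJ_le0; set c := Num.conj _; apply/ler_addgt0Pl => e e0; rewrite addr0.
  pose K := 1 + `|C| * complex.Re `|c|.
  have c0 : 0 <= complex.Re `|c| by rewrite -(@ler0c R) RRe_real// normr_real.
  have K0 : 0 < K by rewrite ltr_pwDl ?mulr_ge0.
  have [m /= phim mp] := (closure_rnormP _ _).1 Mp _ (divr_gt0 e0 K0).
  rewrite -[X in c * X]subr0 -phim -phiB -phiZ (le_trans (phiC _))//.
  rewrite rnormZ rnormBC mulrA.
  have h1 : C * complex.Re `|c| <= `|C| * complex.Re `|c| by rewrite ler_wpM2r// ler_norm.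
  apply: le_trans (ler_wpM2r (rnorm_ge0 _) h1) _.
  apply: le_trans (ler_wpM2l (mulr_ge0 (normr_ge0 C) c0) (ltW mp)) _.
  by rewrite mulrA ler_pdivrMr// mulrC ler_wpM2l ?ltW// /K; lra.
have z0 : x - p != 0 by apply: contra_neq phix => z0; rewrite -[x](subrK p) z0 add0r.
have zz0 : '[x - p, x - p]_H != 0.
  by rewrite -hdot_norm expf_eq0/= normr_eq0.
have phiz : phi (x - p) = phi x by rewrite phiB phip subr0.
(* Since [phi (x - p) = phi x], subtracting [phi u / phi x] times [x - p] from [u] gives an element
   of the kernel, orthogonal to [x - p]. *)
exists ((Num.conj (phi x / '[x - p, x - p]_H)) *: (x - p)) => u.
rewrite linearZr_LR/= conjCK.
have /= := xp (u - (phi u / phi x) *: (x - p)).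
rewrite phiB phiZ phiz divfK// subrr => /(_ erefl).
rewrite linearBr linearZr_LR/= => /eqP; rewrite subr_eq0 => /eqP xpu.
have -> : '[u, x - p]_H = Num.conj '[x - p, u]_H by rewrite [LHS]hermC/= expr0 mul1r.
rewrite xpu rmorphM/= conjCK.
rewrite [X in _ * (_ * X)](_ : _ = '[x - p, x - p]_H); last first.
  by rewrite [RHS]hermC/= expr0 mul1r.
by move: ('[x - p, x - p]_H) zz0 => s s0; field; rewrite phix s0.
Qed.

(** By Riesz the set in [adjoint] is nonempty, so [xget] does not return its default 0. *)
Lemma adjointP H1 H2 (Phi : {linear H1 -> H2}) : continuous Phi ->
  forall u v, '[Phi u, v]_H = '[u, adjoint Phi v]_H.
Proof.
move=> /continuous_rnorm_bounded[M M0 PhiM] u v.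
have [|w|w wP] := @riesz H1 (fun u => '[Phi u, v]_H) (M * rnorm v).
- by move=> c x y; rewrite linearP linearPl.
- by rewrite mulrAC (le_trans (rdot_le _ _))// ler_wpM2r ?rnorm_ge0.
by rewrite /adjoint; case: xgetP => [_ -> /(_ u)//|/(_ w)] /=.
Qed.

(* The set [M] of all [g] represented by some [u] is dense, since any [x]
   orthogonal to [M] satisfies [b x x = 0]; coercivity then makes it closed. *)
Lemma lax_milgram V (b : V -> V -> R[i]) (C mu : R) : 0 < mu ->
  (forall c u v w, b (c *: u + v) w = c * b u w + b v w) ->
  (forall c u v w, b u (c *: v + w) = Num.conj c * b u v + b u w) ->
  (forall u v, complex.Re (b u v) <= C * rnorm u * rnorm v) ->
  (forall u, mu * rnorm u ^+ 2 <= complex.Re (b u u)) ->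
  forall g, exists u, forall v, b u v = '[g, v]_H.
Proof.
move=> mu0 bl br bC bmu.
have bB u u' v : b (u - u') v = b u v - b u' v.
  by rewrite addrC -scaleN1r bl mulN1r addrC.
have b0 v : b 0 v = 0 by rewrite -(subrr 0) bB subrr.
pose M := [set g | exists u, forall v, b u v = '[g, v]_H].
have M_closure g : closure M g.
  have [|c g1 g2 [u1 u1P] [u2 u2P]|p Mp gp] := @orthogonal_projection R V M g.
  - by exists 0 => v; rewrite linear0l b0.
  - by exists (c *: u1 + u2) => v; rewrite bl u1P u2P linearPl.
  (* Conjugating makes the functional linear in [v]. Its Riesz vector [w] belongs to [M], being
     represented by [g - p], so it is orthogonal to [g - p]. *)
  have [|v|w wP] := @riesz V (fun v => Num.conj (b (g - p) v)) (C * rnorm (g - p)).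
  - by move=> c x y; rewrite br rmorphD rmorphM/= conjCK.
  - by rewrite -(@lecR R) complexRe Re_conj -complexRe lecR bC.
  have b_eq0 : b (g - p) (g - p) = 0.
    apply/(can_inj conjCK); rewrite wP conjC0; apply: gp.
    exists (g - p) => v; apply/(can_inj conjCK); rewrite wP.
    by rewrite [LHS]hermC/= expr0 mul1r.
  have := bmu (g - p); rewrite b_eq0/= pmulr_rle0// => gp0.
  rewrite -(subrK p g) (_ : g - p = 0) ?add0r//; apply/rnorm_eq0/eqP.
  by rewrite -sqrf_eq0 eq_le gp0 sqr_ge0.
move=> g.
have gM (n : nat) : exists p : V * V, rnorm (p.2 - g) < n.+1%:R^-1 /\
    forall v, b p.1 v = '[p.2, v]_H.
  have [|g' [u ug'] gg'] := (closure_rnormP _ _).1 (M_closure g) n.+1%:R^-1.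
    by rewrite invr_gt0.
  by exists (u, g').
have [p pP] := choice gM.
(* Coercivity and Cauchy-Schwarz, divided by the norm of the difference when it is nonzero:
   convergence of the data passes to the solutions. *)
have stab n m : mu * rnorm ((p n).1 - (p m).1) <= rnorm ((p n).2 - (p m).2).
  have := bmu ((p n).1 - (p m).1).
  rewrite bB (pP n).2 (pP m).2 -linearBl -/(rdot _ _) => h.
  have := le_trans h (rdot_le _ _); rewrite expr2 mulrA.
  case: (ltP 0 (rnorm ((p n).1 - (p m).1))) => [r0|r0 _]; first by rewrite ler_pM2r.
  by rewrite (le_trans _ (rnorm_ge0 _))// pmulr_rle0.
have gsmall (e : R) : 0 < e -> exists N, forall n, (N <= n)%N -> rnorm ((p n).2 - g) < e.
  move=> e0; have [N _ Ne] := near_infty_natSinv_lt (PosNum e0).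
  by exists N => n /Ne; apply: lt_trans; exact: (pP n).1.
have [e e0|u pu] := @cvg_seq_rnorm R V (fun n => (p n).1).
  have [N Ne] := gsmall (mu * e / 2) ltac:(by rewrite divr_gt0// mulr_gt0).
  exists N => n Nn; rewrite -(ltr_pM2l mu0) (le_lt_trans (stab _ _))//.
  rewrite (le_lt_trans (ler_rdistD g _ _))// (rnormBC g).
  by have := Ne _ Nn; have := Ne _ (leqnn N); lra.
exists u.
(* An upper bound on the real part suffices: at [z *: v] it will read |z|^2 <= 0. *)
have small v : complex.Re (b u v - '[g, v]_H) <= 0.
  apply/ler_addgt0Pl => e e0; rewrite addr0.
  pose K := 1 + (`|C| + 1) * rnorm v.
  have K0 : 0 < K by rewrite ltr_pwDl// mulr_ge0// ?rnorm_ge0// addr_ge0.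
  have [N1 N1e] := pu _ (divr_gt0 e0 K0); have [N2 N2e] := gsmall _ (divr_gt0 e0 K0).
  pose n := maxn N1 N2.
  have {N1e} h1 := N1e n (leq_maxl _ _); have {N2e} h2 := N2e n (leq_maxr _ _).
  have -> : b u v - '[g, v]_H = b (u - (p n).1) v + '[(p n).2 - g, v]_H.
    by rewrite bB (pP n).2 linearBl subrKA.
  rewrite raddfD/= -/(rdot _ _).
  have := bC (u - (p n).1) v; have := rdot_le ((p n).2 - g) v.
  rewrite (rnormBC u).
  have : C * rnorm ((p n).1 - u) * rnorm v <= `|C| * (e / K) * rnorm v.
    rewrite ler_wpM2r ?rnorm_ge0//.
    by apply: le_trans (ler_wpM2r (rnorm_ge0 _) (ler_norm C)) _; rewrite ler_wpM2l// ltW.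
  have : rnorm ((p n).2 - g) * rnorm v <= e / K * rnorm v.
    by rewrite ler_wpM2r ?rnorm_ge0// ltW.
  have : e = e / K + `|C| * (e / K) * rnorm v + e / K * rnorm v.
    by rewrite -{1}[e](divfK (lt0r_neq0 K0)) {2}/K; ring.
  move=> eE h3 h4 h5 h6; apply: le_trans (lerD h6 h5) _.
  by apply: le_trans (lerD h4 h3) _; rewrite [leRHS]eE -addrA lerDr divr_ge0 ?ltW.
move=> v; apply/eqP; rewrite -subr_eq0; apply/eqP/Re_mulcJ_le0.
set z := b u v - '[g, v]_H.
have b0r : b u 0 = 0 by have := br (-1) u 0 0; rewrite scaler0 addr0 rmorphN1 mulN1r addNr.
have := small (z *: v).
by rewrite -[z *: v]addr0 br b0r addr0 addr0 linearZr_LR/= -mulrBr.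
Qed.

(** Continuity at the origin bounds [a] by 1 on a product of balls; rescaling both arguments to half
    the radii gives the constant by homogeneity. *)
Lemma form_bounded V (a : {sesqui V}) : form_continuous a ->
  exists C : R, forall u v, complex.Re (a u v) <= C * rnorm u * rnorm v.
Proof.
move=> /(_ (0, 0)) /cvgrPdist_lt /(_ 1 ltr01) [[A B] /= [A0 B0] AB].
have [[d1 i1] /=] := (nbhs_normP _ _).1 A0.
rewrite ltcE/= => /andP[/eqP-> d10] d1A.
have [[d2 i2] /=] := (nbhs_normP _ _).1 B0.
rewrite ltcE/= => /andP[/eqP-> d20] d2B.
pose r1 := d1 / 2; pose r2 := d2 / 2.
have r10 : 0 < r1 by rewrite divr_gt0.
have r20 : 0 < r2 by rewrite divr_gt0.
have small u v : rnorm u < d1 -> rnorm v < d2 -> complex.Re (a u v) < 1.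
  move=> ud vd; have /= := AB (u, v); rewrite linear0l sub0r normrN => h.
  apply: le_lt_trans (Re_le_normc _) _; rewrite -ltcR RRe_real ?normr_real//.
  apply: h; split; [apply: d1A|apply: d2B].
  - by rewrite /ball_/= sub0r normrN -rnormE ltcR.
  - by rewrite /ball_/= sub0r normrN -rnormE ltcR.
exists ((r1 * r2)^-1) => u v.
have [->|u0] := eqVneq u 0; first by rewrite linear0l/= rnorm0 mulr0 mul0r.
have [->|v0] := eqVneq v 0; first by rewrite linear0r/= rnorm0 mulr0.
have ru : 0 < rnorm u by rewrite lt0r rnorm_ge0 andbT; apply: contra_neq u0 => /rnorm_eq0.
have rv : 0 < rnorm v by rewrite lt0r rnorm_ge0 andbT; apply: contra_neq v0 => /rnorm_eq0.
have := small (((r1 / rnorm u)%:C)%C *: u) (((r2 / rnorm v)%:C)%C *: v).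
rewrite !rnormZr !gtr0_norm ?(divr_gt0 r10 ru) ?(divr_gt0 r20 rv)//.
rewrite !divfK ?gt_eqF// linearZl_LR/= linearZr_LR/=.
have -> : Num.conj ((r2 / rnorm v)%:C)%C = ((r2 / rnorm v)%:C)%C by exact: conjc_real.
have ReZ (r : R) (z : R[i]) : complex.Re (r%:C%C * z) = r * complex.Re z.
  by case: z => x y /=; rewrite mul0r subr0.
rewrite !ReZ => h.
rewrite -mulrA [leRHS]mulrC ler_pdivlMr ?mulr_gt0//.
have : r1 / rnorm u * (r2 / rnorm v * complex.Re (a u v)) <= 1.
  by apply/ltW/h; rewrite /r1 /r2; lra.
have -> : r1 / rnorm u * (r2 / rnorm v * complex.Re (a u v)) =
    complex.Re (a u v) * (r1 * r2) / (rnorm u * rnorm v).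
  by field; rewrite !gt_eqF.
by rewrite ler_pdivrMr ?mulr_gt0// mul1r.
Qed.

(** * The operator associated with an elliptic form *)

Section FormOperator.
Context {V H : hilbertType R} (j : {linear V -> H}) (a : {sesqui V}).
Hypothesis hj : dense_embedding j.
Implicit Types (u f g : H) (v w : V).

Lemma range_orthogonal0 f : (forall v, '[f, j v]_H = 0) -> f = 0.
Proof.
move=> fj; apply: (@closure_orthogonal0 _ (range j)); last by move=> _ [v _ <-].
move=> B; rewrite nbhsE => -[U [oU Uf] UB].
have [||x [Ux jx]] := dense_embedding_dense hj (O := U) => //; first by exists f.
by exists x; split=> //; exact: UB.
Qed.

Lemma form_graph_fun u f g : form_graph j a u f -> form_graph j a u g -> f = g.
Proof.
move=> [w <- wf] [w' /(dense_embedding_inj hj)-> wg].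
apply/eqP; rewrite -subr_eq0; apply/eqP/range_orthogonal0 => v.
by rewrite linearBl/= -wf -wg subrr.
Qed.

Lemma form_op_graph u f : form_graph j a u f -> form_op j a u = f.
Proof.
move=> uf; rewrite /form_op; case: xgetP => [g -> /form_graph_fun|/(_ f)//].
exact.
Qed.

Lemma form_graph_op u : form_dom j a u -> form_graph j a u (form_op j a u).
Proof. by move=> [f uf]; rewrite (form_op_graph uf). Qed.

Lemma form_graphP (c : R[i]) u f u' f' : form_graph j a u f ->
  form_graph j a u' f' -> form_graph j a (c *: u + u') (c *: f + f').
Proof.
move=> [w <- wf] [w' <- wf']; exists (c *: w + w'); first by rewrite linearP.
by move=> v; rewrite !linearPl wf wf'.
Qed.

Lemma form_graphB u f u' f' : form_graph j a u f ->
  form_graph j a u' f' -> form_graph j a (u - u') (f - f').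
Proof.
move=> uf u'f'; rewrite addrC -(scaleN1r u') [f - f']addrC -(scaleN1r f').
exact: form_graphP.
Qed.

Lemma elliptic_real : elliptic j a -> exists omega mu : R, 0 < mu /\
  forall v, mu * rnorm v ^+ 2 <= complex.Re (a v v) + omega * rnorm (j v) ^+ 2.
Proof.
move=> [omega [mu [mu0 aP]]]; exists omega, mu; split=> // v.
by have := aP v; rewrite -!rnormE -complexRe -!rmorphXn/= -!rmorphM/= -rmorphD/= lecR.
Qed.

(** The coercive term is dropped, and |omega| replaces omega because Gronwall will need a
    nonnegative constant. *)
Lemma form_graph_accretive : elliptic j a -> exists2 omega : R, 0 <= omega &
  forall u f, form_graph j a u f -> - rdot f u <= omega * rnorm u ^+ 2.
Proof.
move=> /elliptic_real[omega [mu [mu0 aP]]]; exists `|omega| => // u f [w <- wf].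
have := aP w; rewrite wf -/(rdot _ _) => h.
have : 0 <= mu * rnorm w ^+ 2 by rewrite mulr_ge0 ?sqr_ge0// ltW.
have : omega * rnorm (j w) ^+ 2 <= `|omega| * rnorm (j w) ^+ 2.
  by rewrite ler_wpM2r ?sqr_ge0// ler_norm.
by lra.
Qed.

(** Let [p] be the projection of [u] on the closure of D(A). Solving (A + omega) j w = u - p puts
    [j w] in D(A), so b(w, w) = (u - p, j w) = 0 and [w = 0] by coercivity; hence [u = p]. *)
Lemma form_dom_dense : form_continuous a -> elliptic j a ->
  forall u, closure (form_dom j a) u.
Proof.
move=> /form_bounded[C aC] /elliptic_real[omega [mu [mu0 aP]]] u.
have [M M0 jM] := continuous_rnorm_bounded (dense_embedding_continuous hj).
pose b v w : R[i] := a v w + (omega%:C)%C * '[j v, j w]_H.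
have bE w : complex.Re (b w w) = complex.Re (a w w) + omega * rnorm (j w) ^+ 2.
  rewrite /b raddfD/= rnorm_sqr /rdot; congr (_ + _).
  by case: ('[_, _]_H) => x y /=; rewrite mul0r subr0.
(* Riesz in [V] turns the functional v -> (j v, f) into a vector [g] of [V], the right-hand side
   that Lax-Milgram expects. *)
have b_solve f : exists w, forall v, b w v = '[f, j v]_H.
  have [c x y|x|g gP] := @riesz V (fun v => '[j v, f]_H) (M * rnorm f).
  - by rewrite linearP linearPl.
  - by rewrite (le_trans (rdot_le _ _))// mulrAC ler_wpM2r ?rnorm_ge0.
  have [c v v' w|c v w w'|v w|v|w wP] := @lax_milgram V b (C + `|omega| * M ^+ 2)
    mu mu0 _ _ _ _ g.
  - rewrite /b (linearP j) !linearPl/=.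
    by move: (a v w) (a v' w) '[j v, j w]_H '[j v', j w]_H => p q r s; ring.
  - rewrite /b (linearP j) (linearPr a) (linearPr hdot)/=.
    by move: (a v w) (a v w') '[j v, j w]_H '[j v, j w']_H => p q r s; ring.
  - rewrite /b raddfD/=.
    have -> : complex.Re ((omega%:C)%C * '[j v, j w]_H) = rdot (((omega%:C)%C) *: j v) (j w).
      by rewrite /rdot linearZl_LR.
    rewrite mulrDl mulrDl lerD// (le_trans (rdot_le _ _))// rnormZr expr2 !mulrA.
    rewrite -!mulrA ler_wpM2l// [leRHS]mulrCA mulrCA.
    rewrite [leRHS](_ : _ = (M * rnorm v) * (M * rnorm w)); last by ring.
    by rewrite ler_pM ?rnorm_ge0.
  - by rewrite bE.
  exists w => v; rewrite wP [LHS]hermC/= expr0 mul1r -gP [RHS]hermC/=.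
  by rewrite expr0 mul1r.
have [|c x y [f xf] [g yg]|p Dp up] := @orthogonal_projection R H (form_dom j a) u.
- by exists 0, 0; rewrite ?linear0// => v; rewrite !linear0l.
- by exists (c *: f + g); exact: form_graphP.
suff -> : u = p by [].
apply/eqP; rewrite -subr_eq0; apply/eqP/range_orthogonal0 => v.
have [w wP] := b_solve (u - p).
have Djw : form_dom j a (j w).
  exists ((u - p) - (omega%:C)%C *: j w), w => // x.
  by rewrite linearBl/= linearZl_LR/= -wP addrK.
have := aP w; rewrite -wP -bE [b w w]wP up// raddf0/= pmulr_rle0// => w0.
have -> : w = 0.
  by apply/rnorm_eq0/eqP; rewrite -sqrf_eq0 eq_le w0 sqr_ge0.
by rewrite /b linear0 !linear0l mulr0 addr0.
Qed.

End FormOperator.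
End Forms.

(** * Uniform boundedness and semigroups *)

Section UniformBoundedness.
Context {R : realType}.

(** If one constant bounds the family on some ball, homogeneity spreads the bound. Otherwise
    completeness yields a point where the family is unbounded. *)
Lemma uniform_boundedness (V : completeNormedModType R[i]) (W : normedModType R[i])
    (T : nat -> {linear V -> W}) :
  (forall n, continuous (T n)) ->
  (forall x, exists M, forall n, rnorm (T n x) <= M) ->
  exists2 M, 0 < M & forall n x, rnorm (T n x) <= M * rnorm x.
Proof.
move=> cT bT.
have [[x [r [K [r0 K_ub]]]]|unbounded] := pselect (exists x r K, 0 < r /\
    forall i y, rnorm (y - x) < r -> rnorm (T i y) <= K).
  have K0 : 0 <= K by apply: le_trans (rnorm_ge0 (T 0 x)) (K_ub _ _ _); rewrite subrr rnorm0.
  (* On vectors of norm [r / 2] the operators are differences of two values in the ball, so at most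
     [2 * K]; adding 1 keeps the constant positive. *)
  exists (4 * K / r + 1); first by rewrite ltr_wpDl// divr_ge0 ?mulr_ge0// ltW.
  move=> i y; have [->|y0] := eqVneq y 0; first by rewrite linear0 !rnorm0 mulr0.
  have ny : 0 < rnorm y by rewrite lt0r rnorm_ge0 andbT; apply: contra_neq y0 => /rnorm_eq0.
  have c0 : 0 < r / 2 / rnorm y by rewrite !divr_gt0.
  have h1 := K_ub i (x + ((r / 2 / rnorm y)%:C)%C *: y).
  have h2 := K_ub i x.
  rewrite subrr rnorm0 in h2; rewrite addrAC subrr add0r rnormZr gtr0_norm// divfK ?gt_eqF// in h1.
  have := ler_rnormB (T i (x + ((r / 2 / rnorm y)%:C)%C *: y)) (T i x).
  rewrite -linearB addrAC subrr add0r linearZ/= rnormZr gtr0_norm// => h3.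
  have h4 : r / 2 / rnorm y * rnorm (T i y) <= 2 * K.
    apply: le_trans h3 _; have := h2 r0; have := h1 ltac:(by lra); lra.
  have h5 : rnorm (T i y) <= 2 * K / (r / 2 / rnorm y) by rewrite ler_pdivlMr// mulrC.
  apply: le_trans h5 _.
  rewrite (_ : 2 * K / _ = 4 * K / r * rnorm y); last by field; rewrite !gt_eqF.
  by rewrite ler_wpM2r ?rnorm_ge0// lerDl.
(* Nested closed balls [s n], on each of which some [T i] exceeds [n]. *)
exfalso.
have step (ns : nat * (V * {posnum R})) : exists s : V * {posnum R},
    [/\ rnorm (s.1 - ns.2.1) + s.2%:num <= ns.2.2%:num, s.2%:num <= ns.1.+1%:R^-1 &
     exists i, forall y, rnorm (y - s.1) <= s.2%:num -> ns.1%:R <= rnorm (T i y)].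
  case: ns => n [x r] /=.
  have [y [i [yx Ty]]] : exists y i, rnorm (y - x) < r%:num /\ n.+1%:R < rnorm (T i y).
    apply: contrapT => none; apply: unbounded; exists x, r%:num, n.+1%:R; split=> // i y yx.
    by rewrite leNgt; apply/negP => Ty; apply: none; exists y, i.
  have [M M0 TM] := continuous_rnorm_bounded (cT i).
  (* The three bounds keep the new ball inside the old one, let [T i] lose at most 1 (from [n.+1] to
     [n]), and make the radii tend to 0. *)
  pose r' := Num.min (r%:num - rnorm (y - x)) (Num.min M^-1 n.+1%:R^-1).
  have r'0 : 0 < r' by rewrite !lt_min subr_gt0 yx !invr_gt0 M0 ltr0n.
  exists (y, PosNum r'0) => /=; split.
  - have : r' <= r%:num - rnorm (y - x) by rewrite /r' ge_min lexx.
    lra.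
  - by rewrite /r' !ge_min lexx !orbT.
  - exists i => z zy.
    have : M * rnorm (z - y) <= 1.
      rewrite mulrC -ler_pdivlMr// mul1r (le_trans zy)//.
      by rewrite /r' !ge_min lexx orbT.
    have := TM (z - y); have := ler_rnormB (T i z) (T i z - T i y).
    rewrite subKr -linearB; move: Ty; rewrite -natr1; lra.
have [f fP] := choice step.
pose s := fix s n := if n is n'.+1 then f (n', s n') else (0, PosNum (@ltr01 R)).
have sP n : [/\ rnorm ((s n.+1).1 - (s n).1) + (s n.+1).2%:num <= (s n).2%:num,
    (s n.+1).2%:num <= n.+1%:R^-1 &
    exists i, forall y, rnorm (y - (s n.+1).1) <= (s n.+1).2%:num -> n%:R <= rnorm (T i y)].
  exact: fP (n, s n).
(* Carrying the radius along with the distance between centers lets the induction telescope. *)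
have s_dist n k : rnorm ((s (k + n)%N).1 - (s n).1) + (s (k + n)%N).2%:num <= (s n).2%:num.
  elim: k => [|k IH]; first by rewrite subrr rnorm0 add0r.
  have [h _ _] := sP (k + n)%N; rewrite addSn.
  have := ler_rdistD (s (k + n)%N).1 (s (k + n).+1).1 (s n).1.
  by move: h IH; set A := rnorm _; set B := rnorm _; set C := rnorm _; lra.
have s_ball n m : (n <= m)%N -> rnorm ((s m).1 - (s n).1) <= (s n).2%:num.
  move=> nm; have := s_dist n (m - n)%N; rewrite subnK//.
  by apply: le_trans; rewrite lerDl.
have [e e0|l sl] := @cvg_seq_rnorm R V (fun n => (s n).1).
  have [N _ /(_ N (leqnn N)) Ne] := near_infty_natSinv_lt (PosNum e0).
  exists N.+1 => n Nn; rewrite rnormBC (le_lt_trans (s_ball _ _ Nn))//.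
  by have [_ + _] := sP N; move=> /le_lt_trans; apply.
have [M TM] := bT l.
have [_ _ [i Ti]] := sP (Num.truncn M).+1.
set n := (Num.truncn M).+1 in Ti.
have ln : rnorm (l - (s n.+1).1) <= (s n.+1).2%:num.
  apply/ler_addgt0Pl => e /sl[N Ne].
  have h1 := Ne _ (leq_maxl N n.+1); have h2 := s_ball _ _ (leq_maxr N n.+1).
  rewrite (le_trans (ler_rdistD (s (maxn N n.+1)).1 _ _))//.
  by rewrite rnormBC lerD// ltW.
have := le_trans (Ti l ln) (TM i).
by rewrite leNgt truncnS_gt.
Qed.

End UniformBoundedness.

(** * Strongly continuous semigroups and their generators *)

Section Semigroups.
Context {R : realType}.

Lemma near_at_right0P (P : R -> Prop) :
  (\forall t \near 0^'+, P t) <->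
  exists2 d : R, 0 < d & forall t, 0 < t -> t < d -> P t.
Proof.
split=> [[d /= d0 dP]|[d d0 dP]]; exists d => //= t.
  by move=> t0 td; apply: dP => //=; rewrite sub0r normrN gtr0_norm.
by move=> /= + t0; rewrite sub0r normrN gtr0_norm//; exact: dP.
Qed.

Lemma cvg_at_right0P (V : normedModType R[i]) (f : R -> V) l :
  (f t @[t --> 0^'+] --> l) <-> (forall e : R, 0 < e ->
    exists2 d : R, 0 < d & forall t, 0 < t -> t < d -> rnorm (f t - l) < e).
Proof.
rewrite cvg_rnormP; split=> h e /h; by rewrite near_at_right0P.
Qed.

Variable H : hilbertType R.
Implicit Types (S : R -> {linear H -> H}) (D : set H) (B : H -> H) (u : H).

(** Otherwise there are times t_n -> 0 with operator norms exceeding [n.+1], although strong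
    continuity at 0 bounds every orbit along them. *)
Lemma C0_semigroup_locally_bounded S : C0_semigroup S -> exists d M : R,
  [/\ 0 < d, 0 < M & forall (t : R) u, 0 < t -> t < d -> rnorm (S t u) <= M * rnorm u].
Proof.
move=> [cS _ S0]; apply: contrapT => none.
have step (n : nat) : exists t, [/\ 0 < t, t < n.+1%:R^-1 &
    exists u, n.+1%:R * rnorm u < rnorm (S t u)].
  apply: contrapT => nex; apply: none; exists n.+1%:R^-1, n.+1%:R.
  split=> // t u t0 tn.
  by rewrite leNgt; apply/negP => Stu; apply: nex; exists t; split=> //; exists u.
have [t tP] := choice step.
have [n|u|M M0 SM] := @uniform_boundedness R H H (fun n => S (t n)).
- by apply: cS; have [] := tP n.
- have [d d0 Sd] := (cvg_at_right0P _ _).1 (S0 u) 1 ltr01.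
  have [N _ Nd] := near_infty_natSinv_lt (PosNum d0).
  (* The sum covers the finitely many times outside the reach of the convergence at 0. *)
  exists (rnorm u + 1 + \sum_(i < N) rnorm (S (t i) u)) => n.
  case: (ltnP n N) => nN.
    rewrite (bigD1 (Ordinal nN))//= addrCA lerDl addr_ge0 ?addr_ge0 ?rnorm_ge0//.
    by rewrite sumr_ge0// => i _; exact: rnorm_ge0.
  have [t0 tn _] := tP n.
  have := Sd _ t0 (lt_trans tn (Nd _ nN)); have := ler_rnormD (S (t n) u - u) u.
  rewrite subrK; have : 0 <= \sum_(i < N) rnorm (S (t i) u).
    by rewrite sumr_ge0// => i _; exact: rnorm_ge0.
  by lra.
- have [_ _ [u]] := tP (Num.truncn M).
  apply/negP; rewrite -leNgt (le_trans (SM _ _))// ler_wpM2r ?rnorm_ge0//.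
  exact/ltW/truncnS_gt.
Qed.

(** The difference is [S (t - h)] applied to [S h u - u]. Splitting [t - h] into the fixed time
    [t - s] and the short time [s - h < d] bounds this operator uniformly in [h]. *)
Lemma C0_semigroup_left_continuous S : C0_semigroup S -> forall (t : R) u, 0 < t ->
  forall e : R, 0 < e -> exists2 d : R, 0 < d &
    forall h, 0 < h -> h < d -> h < t -> rnorm (S t u - S (t - h) u) < e.
Proof.
move=> S0 t u t0 e e0; have [d [M [d0 M0 SM]]] := C0_semigroup_locally_bounded S0.
pose s := Num.min d t / 2.
have m0 : 0 < Num.min d t by rewrite lt_min d0.
have md : Num.min d t <= d by rewrite ge_min lexx.
have mt : Num.min d t <= t by rewrite ge_min lexx orbT.
have s0 : 0 < s by rewrite /s; lra.
have sd : s < d by rewrite /s; lra.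
have st : s < t by rewrite /s; lra.
have ts0 : 0 < t - s by rewrite subr_gt0.
have [M' M'0 SM'] := continuous_rnorm_bounded (C0_semigroup_bounded S0 ts0).
have [d' d'0 Sd'] := (cvg_at_right0P _ _).1 (@C0_semigroup_cvg _ _ _ S0 u)
  (e / (M' * M)) (divr_gt0 e0 (mulr_gt0 M'0 M0)).
exists (Num.min s d'); first by rewrite lt_min s0.
move=> h h0; rewrite lt_min => /andP[hs hd'] ht.
have sh0 : 0 < s - h by rewrite subr_gt0.
have th0 : 0 < t - h by rewrite subr_gt0.
have -> : S t u = S (t - h) (S h u) by rewrite -(C0_semigroupD S0)// subrK.
rewrite -linearB/= (_ : t - h = (t - s) + (s - h)); last by rewrite subrKA.
rewrite (C0_semigroupD S0)//; apply: le_lt_trans (SM' _) _.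
have shd : s - h < d by rewrite ltrBlDr ltr_wpDr// ltW.
rewrite -ltr_pdivlMl//; apply: le_lt_trans (SM _ _ sh0 shd) _.
rewrite -ltr_pdivlMl//; apply: lt_le_trans (Sd' _ h0 hd') _.
by rewrite (_ : e / (M' * M) = M^-1 * (M'^-1 * e))//; field; rewrite !gt_eqF.
Qed.

Lemma generates_quotient D B S : generates D B S -> forall u f,
  generator_quotient S u t @[t --> 0^'+] --> f -> D u /\ B u = f.
Proof.
move=> [_ DE BE] u f uf.
have Du : D u by rewrite DE /=; apply/cvg_ex; exists f.
by split=> //; exact: (cvg_unique _ (BE u Du) uf).
Qed.

Lemma generator_quotient_semigroup S u t h : C0_semigroup S -> 0 < t -> 0 < h ->
  generator_quotient S (S t u) h = S t (generator_quotient S u h).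
Proof.
move=> S0 t0 h0; rewrite /generator_quotient [RHS]linearZ/= (linearB (S t))/=.
by rewrite -(C0_semigroupD S0 h0 t0) -(C0_semigroupD S0 t0 h0) (addrC t).
Qed.

Lemma cvg_linear (V W : normedModType R[i]) (L : {linear V -> W}) (f g : R -> _) l :
  continuous L -> (forall t, 0 < t -> g t = L (f t)) ->
  f t @[t --> 0^'+] --> l -> g t @[t --> 0^'+] --> L l.
Proof.
move=> /continuous_rnorm_bounded[M M0 LM] gL /cvg_at_right0P fl.
apply/cvg_at_right0P => e e0; have [d d0 fd] := fl _ (divr_gt0 e0 M0).
exists d => // t t0 td; rewrite gL// -linearB (le_lt_trans (LM _))//.
by rewrite -ltr_pdivlMl// mulrC fd.
Qed.

Lemma generates_invariant D B S : generates D B S -> forall t u, 0 < t -> D u ->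
  D (S t u).
Proof.
move=> gS t u t0 Du; have S0 := generates_C0 gS.
have [] // := generates_quotient gS (u := S t u) (f := S t (B u)).
apply: cvg_linear (C0_semigroup_bounded S0 t0) _ (generates_cvg gS Du) => h h0.
exact: generator_quotient_semigroup.
Qed.

End Semigroups.

(** * Intertwining operators *)

Lemma subrACA (V : zmodType) (a b c d : V) : (a - b) - (c - d) = (a - c) - (b - d).
Proof. by rewrite !opprB addrACA [RHS]addrACA [- b + _]addrC. Qed.

Section Intertwining.
Context {R : realType}.

(** Consider the supremum of the times up to which [f] stays below a barrier: left control extends
    the bound to the supremum, and the right increment carries it beyond, a contradiction. *)
Lemma right_gronwall (f : R -> R) (K : R) : 0 <= K ->
  (forall e : R, 0 < e -> exists2 d : R, 0 < d &
    forall h, 0 < h -> h < d -> f h <= e) ->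
  (forall t e : R, 0 < t -> 0 < e -> exists2 d : R, 0 < d &
    forall h, 0 < h -> h < d -> f (t + h) <= f t + h * (K * f t + e)) ->
  (forall t e : R, 0 < t -> 0 < e -> exists2 d : R, 0 < d &
    forall h, 0 < h -> h < d -> h < t -> f t <= f (t - h) + e) ->
  forall t, 0 < t -> f t <= 0.
Proof.
move=> K0 f0 f_right f_left T T0; apply/ler_addgt0Pl => e' e'0; rewrite addr0.
(* Barrier: [f] cannot cross [b e], whose slope is at least [K * b e + e]. *)
pose b e t : R := e * expR ((K + 1) * t).
suff fb e : 0 < e -> forall t, 0 < t -> f t <= b e t.
  have E0 := expR_gt0 ((K + 1) * T).
  apply: le_trans (fb (e' / expR ((K + 1) * T)) (divr_gt0 e'0 E0) T T0) _.
  by rewrite /b divfK ?gt_eqF.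
move=> e0 {T T0 e' e'0} T T0; rewrite leNgt; apply/negP => fT.
have K1 : 0 < K + 1 by lra.
have b_mono s t : s <= t -> b e s <= b e t.
  by move=> st; rewrite /b ler_pM2l// ler_expR ler_pM2l.
have b_ge t : 0 <= t -> e <= b e t.
  move=> t0; rewrite -[leLHS]mulr1 /b ler_pM2l// (le_trans _ (expR_ge1Dx _))// lerDl.
  exact: mulr_ge0 (ltW K1) t0.
pose E := [set t | 0 < t /\ forall s, 0 < s -> s <= t -> f s <= b e s].
have [d d0 fd] := f0 e e0.
have Ed : E (d / 2).
  split=> [|s s0 sd]; first by rewrite divr_gt0.
  by apply: le_trans (fd _ s0 _) (b_ge _ (ltW s0)); lra.
have ET t : E t -> t <= T.
  by move=> [_ Et]; rewrite leNgt; apply/negP => /ltW/(Et _ T0); rewrite leNgt fT.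
have supE : has_sup E by split; [exists (d / 2)|exists T].
pose t0 := sup E.
have t00 : 0 < t0.
  by apply: (@lt_le_trans _ _ (d / 2)); [rewrite divr_gt0|exact: sup_upper_bound].
have below s : 0 < s -> s < t0 -> f s <= b e s.
  move=> s0 st; have [t [_ Et] st'] := sup_adherent (ltac:(by rewrite subr_gt0) : 0 < t0 - s) supE.
  by apply: Et => //; move: st'; rewrite -/t0 subKr => /ltW.
have ft0 : f t0 <= b e t0.
  apply/ler_addgt0Pl => x x0; have [c c0 fc] := f_left t0 x t00 x0.
  pose h := Num.min c t0 / 2.
  have m0 : 0 < Num.min c t0 by rewrite lt_min c0.
  have mc : Num.min c t0 <= c by rewrite ge_min lexx.
  have mt : Num.min c t0 <= t0 by rewrite ge_min lexx orbT.
  apply: le_trans (fc h _ _ _) _; rewrite ?/h; [lra|lra|lra|].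
  rewrite addrC lerD2l; apply: le_trans (b_mono (t0 - h) t0 _); last by rewrite /h; lra.
  by apply: below; rewrite /h; lra.
have [c c0 fc] := f_right t0 e t00 e0.
have : E (t0 + c / 2).
  split=> [|s s0 sc]; first by rewrite addr_gt0// divr_gt0.
  have [st|st|->//] := ltgtP s t0; first exact: below.
  pose h := s - t0; have h0 : 0 < h by rewrite subr_gt0.
  have sE : s = t0 + h by rewrite /h addrC subrK.
  have hc : h < c by rewrite /h; lra.
  rewrite sE; apply: le_trans (fc _ h0 hc) _.
  (* The barrier grows at least linearly with slope [(K + 1) * b e t0], which dominates
     [K * f t0 + e] because [e <= b e t0]. *)
  have h1 : 1 + (K + 1) * h <= expR ((K + 1) * h) by exact: expR_ge1Dx.
  rewrite [leRHS](_ : _ = b e t0 * expR ((K + 1) * h)); last first.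
    by rewrite /b -mulrA -expRD -mulrDr.
  have bt0 := b_ge _ (ltW t00).
  have b0 : 0 < b e t0 by apply: lt_le_trans e0 bt0.
  have h2 : b e t0 * (1 + (K + 1) * h) <= b e t0 * expR ((K + 1) * h) by rewrite ler_pM2l.
  apply: le_trans h2; have h3 : h * e <= h * b e t0 by rewrite ler_pM2l.
  have h4 : h * K * f t0 <= h * K * b e t0 by rewrite ler_wpM2l// mulr_ge0// ltW.
  move: h3 h4 ft0; nra.
move=> /(sup_upper_bound supE); rewrite -/t0; lra.
Qed.

Lemma rnorm_sqr_right_derivative (H : hilbertType R) (q : R -> H) (y g : H) (e : R) :
  q t @[t --> 0^'+] --> g -> 0 < e -> exists2 d : R, 0 < d &
    forall h, 0 < h -> h < d ->
      rnorm (y + (h%:C)%C *: q h) ^+ 2 <= rnorm y ^+ 2 + h * (2 * rdot y g + e).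
Proof.
move=> /cvg_at_right0P qg e0.
(* [Y] and [G] are sized so that the error in the inner product and the quadratic term each cost at
   most [e / 2]. *)
pose Y := 1 + 4 * rnorm y; pose G := 1 + 2 * (rnorm g + 1) ^+ 2.
have Y0 : 0 < Y by rewrite ltr_pwDl ?mulr_ge0 ?rnorm_ge0.
have G0 : 0 < G by rewrite /G; have := sqr_ge0 (rnorm g + 1); lra.
have [d1 d10 q1] := qg (e / Y) (divr_gt0 e0 Y0).
have [d2 d20 q2] := qg 1 ltr01.
exists (Num.min d1 (Num.min d2 (e / G))); first by rewrite !lt_min d10 d20 divr_gt0.
move=> h h0; rewrite !lt_min => /and3P[/(q1 _ h0) qh1 /(q2 _ h0) qh2 he].
rewrite rnormD_sqr rnormZr gtr0_norm// rdotC rdotZl rdotC.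
rewrite -addrA lerD2l (_ : 2 * (h * rdot y (q h)) + (h * rnorm (q h)) ^+ 2 =
  h * (2 * rdot y (q h) + h * rnorm (q h) ^+ 2)); last by ring.
rewrite ler_pM2l//.
have -> : rdot y (q h) = rdot y g + rdot y (q h - g).
  by rewrite [RHS]addrC [rdot y g]rdotC [rdot y (q h - g)]rdotC -rdotDl subrK rdotC.
have h1 := rdot_le y (q h - g).
have h2 : rnorm y * rnorm (q h - g) <= rnorm y * (e / Y).
  by rewrite ler_wpM2l ?rnorm_ge0// ltW.
have h3 : 4 * (rnorm y * (e / Y)) <= e.
  by rewrite !mulrA ler_pdivrMr// /Y; have := rnorm_ge0 y; nra.
have h4 : h * rnorm (q h) ^+ 2 <= h * (rnorm g + 1) ^+ 2.
  rewrite ler_wpM2l ?(ltW h0)// lerXn2r ?nnegrE ?addr_ge0 ?rnorm_ge0//.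
  by have := ler_rnormD (q h - g) g; rewrite subrK; lra.
have h5 : 2 * (h * (rnorm g + 1) ^+ 2) <= e.
  by move: he; rewrite ltr_pdivlMr// /G; have := sqr_ge0 (rnorm g + 1); nra.
by move: h1 h2 h3 h4 h5; lra.
Qed.

Variables (H1 H2 V1 V2 : hilbertType R).
Variables (j1 : {linear V1 -> H1}) (j2 : {linear V2 -> H2}).
Variables (a1 : {sesqui V1}) (a2 : {sesqui V2}).
Variable Phi : {linear H1 -> H2}.
Hypotheses (hj1 : dense_embedding j1) (hj2 : dense_embedding j2).
Hypothesis cPhi : continuous Phi.

Lemma intertwining_form_graph :
  Phi @` range j1 `<=` range j2 ->
  adjoint Phi @` range j2 `<=` range j1 ->
  (forall (u : V1) (v : V2) (Phiu : V2) (Phisv : V1),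
    j2 Phiu = Phi (j1 u) -> j1 Phisv = adjoint Phi (j2 v) ->
    a2 Phiu v = a1 u Phisv) ->
  forall u f, form_graph j1 a1 u f -> form_graph j2 a2 (Phi u) (Phi f).
Proof.
move=> PhiV adjV a12 _ f [w <- wf].
have [|w' _ w'E] := PhiV (Phi (j1 w)); first by exists (j1 w) => //; exists w.
exists w' => // v.
have [|v' _ v'E] := adjV (adjoint Phi (j2 v)); first by exists (j2 v) => //; exists v.
by rewrite (a12 _ _ _ _ w'E v'E) wf v'E -adjointP.
Qed.

Variables (S1 : R -> {linear H1 -> H1}) (S2 : R -> {linear H2 -> H2}).
Hypothesis gS1 : generates (form_dom j1 a1) (fun u => - form_op j1 a1 u) S1.
Hypothesis gS2 : generates (form_dom j2 a2) (fun u => - form_op j2 a2 u) S2.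

Lemma intertwining_generator :
  (forall t : R, 0 < t -> forall u, S2 t (Phi u) = Phi (S1 t u)) ->
  forall u, form_dom j1 a1 u ->
    form_dom j2 a2 (Phi u) /\ form_op j2 a2 (Phi u) = Phi (form_op j1 a1 u).
Proof.
move=> S12 u Du.
have [|DPhiu opE] := generates_quotient gS2 (u := Phi u) (f := Phi (- form_op j1 a1 u)).
- apply: cvg_linear cPhi _ (generates_cvg gS1 Du) => t t0.
  by rewrite /generator_quotient S12// -linearB -linearZ.
by split=> //; apply: oppr_inj; rewrite opE linearN.
Qed.

Hypotheses (ca1 : form_continuous a1) (ea1 : elliptic j1 a1) (ea2 : elliptic j2 a2).

(** Inclusion of graphs is the form in which both (ii) and (iii) enter, so a single Gronwall
    argument serves both. *)
Lemma intertwining_semigroup_dom :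
  (forall u f, form_graph j1 a1 u f -> form_graph j2 a2 (Phi u) (Phi f)) ->
  forall t u, 0 < t -> form_dom j1 a1 u -> S2 t (Phi u) = Phi (S1 t u).
Proof.
move=> graph12 t u t0 Du.
have [S10 S20] := (generates_C0 gS1, generates_C0 gS2).
have [omega omega0 acc] := form_graph_accretive ea2.
have [M M0 PhiM] := continuous_rnorm_bounded cPhi.
have DPhi v : form_dom j1 a1 v -> form_dom j2 a2 (Phi v).
  by move=> /(form_graph_op hj1)/graph12 vf; exists (Phi (form_op j1 a1 v)).
pose y t := S2 t (Phi u) - Phi (S1 t u).
suff : rnorm (y t) ^+ 2 <= 0.
  move=> yt; apply/eqP; rewrite -subr_eq0; apply/eqP/rnorm_eq0/eqP.
  by rewrite -sqrf_eq0 eq_le yt sqr_ge0.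
apply: (@right_gronwall (fun t => rnorm (y t) ^+ 2) (2 * omega)) t0; first by rewrite mulr_ge0.
- move=> e e0; have E0 : 0 < Num.sqrt e by rewrite sqrtr_gt0.
  have [d1 d10 h1] := (cvg_at_right0P _ _).1 (@C0_semigroup_cvg _ _ _ S20 (Phi u))
    (Num.sqrt e / 2) (divr_gt0 E0 (ltr0Sn _ 1)).
  have PhiS1 : Phi (S1 s u) @[s --> 0^'+] --> Phi u.
    by apply: (cvg_linear cPhi) (@C0_semigroup_cvg _ _ _ S10 u).
  have [d2 d20 h2] := (cvg_at_right0P _ _).1 PhiS1 (Num.sqrt e / 2) (divr_gt0 E0 (ltr0Sn _ 1)).
  exists (Num.min d1 d2); first by rewrite lt_min d10.
  move=> h h0; rewrite lt_min => /andP[/(h1 _ h0) k1 /(h2 _ h0) k2].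
  rewrite -(sqr_sqrtr (ltW e0)) lerXn2r ?nnegrE ?rnorm_ge0 ?sqrtr_ge0//.
  have := ler_rdistD (Phi u) (S2 h (Phi u)) (Phi (S1 h u)).
  by rewrite (rnormBC (Phi u)) -/(y h); lra.
- move=> {}t e t0 e0.
  have D1 : form_dom j1 a1 (S1 t u) := generates_invariant gS1 t0 Du.
  have D2 : form_dom j2 a2 (S2 t (Phi u)) := generates_invariant gS2 t0 (DPhi _ Du).
  set f1 := form_op j1 a1 (S1 t u); set f2 := form_op j2 a2 (S2 t (Phi u)).
  (* [graph12] puts [Phi (S1 t u)] in D(A_2), so ellipticity of [a2] can be applied to [y t]. *)
  have yg : form_graph j2 a2 (y t) (f2 - Phi f1).
    by apply: form_graphB; [exact: form_graph_op|exact/graph12/form_graph_op].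
  pose q h := generator_quotient S2 (S2 t (Phi u)) h - Phi (generator_quotient S1 (S1 t u) h).
  have qcvg : q h @[h --> 0^'+] --> - f2 - Phi (- f1).
    apply: cvgB; first exact: (generates_cvg gS2 D2).
    exact: (cvg_linear cPhi) (generates_cvg gS1 D1).
  have [d d0 dP] := rnorm_sqr_right_derivative (y t) qcvg e0.
  exists d => // h h0 hd.
  have -> : y (t + h) = y t + (h%:C)%C *: q h.
    rewrite /q /generator_quotient linearZ/= -scalerBr scalerA.
    rewrite -rmorphM/= divff ?gt_eqF// scale1r linearB/=.
    rewrite -(C0_semigroupD S20 h0 t0) -(C0_semigroupD S10 h0 t0) (addrC h).
    by rewrite subrACA -/(y t) [RHS]addrC subrK /y addrC.
  apply: le_trans (dP _ h0 hd) _; rewrite lerD2l ler_pM2l// lerD2r.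
  have := acc _ _ yg; rewrite linearN opprK (_ : - f2 + Phi f1 = - (f2 - Phi f1));
    last by rewrite opprB addrC.
  by rewrite rdotNr rdotC; lra.
(* Left continuity of [y] has to pass to its squared norm: |y(t)| <= |y(t - h)| + n gives an excess
   of at most 2 n |y(t)|, which is below [e] by the choice of [n]. *)
- move=> {}t e t0 e0; pose n := e / (2 * (rnorm (y t) + 1)).
  have yt0 := rnorm_ge0 (y t).
  have n0 : 0 < n by rewrite divr_gt0// mulr_gt0// ltr_wpDl.
  have nE : 2 * n * (rnorm (y t) + 1) = e by rewrite /n; field; lra.
  have [d1 d10 h1] := C0_semigroup_left_continuous S20 (Phi u) t0 (divr_gt0 n0 (ltr0Sn _ 1)).
  have [d2 d20 h2] := C0_semigroup_left_continuous S10 u t0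
    (divr_gt0 n0 (mulr_gt0 (ltr0Sn _ 1) M0)).
  exists (Num.min d1 d2); first by rewrite lt_min d10.
  move=> h h0; rewrite lt_min => /andP[/(h1 _ h0) k1 /(h2 _ h0) k2] ht.
  have {}k1 := k1 ht; have {}k2 := k2 ht.
  have k3 : rnorm (Phi (S1 t u - S1 (t - h) u)) <= n / 2.
    rewrite (le_trans (PhiM _))// -ler_pdivlMl// (le_trans (ltW k2))//.
    by rewrite (_ : n / (2 * M) = M^-1 * (n / 2))//; field; rewrite gt_eqF.
  have := ler_rnormD (y t - y (t - h)) (y (t - h)); rewrite subrK.
  have := ler_rnormB (S2 t (Phi u) - S2 (t - h) (Phi u)) (Phi (S1 t u - S1 (t - h) u)).
  rewrite (_ : _ - _ - _ = y t - y (t - h)); last first.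
    by rewrite linearB/= subrACA.
  have := rnorm_ge0 (y (t - h)); move: (rnorm (y (t - h))) k1 k3 nE yt0.
  move: (rnorm (y t)) (rnorm (y t - _)) => A C B k1 k3 nE A0 B0 C1 C2.
  have AB : A <= B + n by lra.
  suff : A ^+ 2 <= B ^+ 2 + 2 * n * A by lra.
  have nA : 0 <= n * A by rewrite mulr_ge0// ltW.
  (* Squaring [A - n <= B] requires [A - n] to be nonnegative. *)
  have [An|An] := lerP A n.
    have : A ^+ 2 <= n * A by rewrite expr2 ler_wpM2r.
    by have := sqr_ge0 B; lra.
  have : (A - n) ^+ 2 <= B ^+ 2 by rewrite lerXn2r// ?nnegrE; lra.
  by rewrite sqrrB; have := sqr_ge0 n; lra.
Qed.

(** Both sides are bounded in [u] and agree on the dense domain of A_1; [K] bounds their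
    difference. *)
Lemma intertwining_semigroup :
  (forall u f, form_graph j1 a1 u f -> form_graph j2 a2 (Phi u) (Phi f)) ->
  forall t : R, 0 < t -> forall u, S2 t (Phi u) = Phi (S1 t u).
Proof.
move=> graph12 t t0 u.
have [M M0 PhiM] := continuous_rnorm_bounded cPhi.
have [M1 M10 S1M] := continuous_rnorm_bounded (C0_semigroup_bounded (generates_C0 gS1) t0).
have [M2 M20 S2M] := continuous_rnorm_bounded (C0_semigroup_bounded (generates_C0 gS2) t0).
apply/eqP; rewrite -subr_eq0; apply/eqP/rnorm_small => e e0.
pose K := M2 * M + M * M1.
have K0 : 0 < K by rewrite addr_gt0// mulr_gt0.
have /closure_rnormP/(_ _ (divr_gt0 e0 K0))[v Dv vu] : closure (form_dom j1 a1) u.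
  exact: form_dom_dense.
have -> : S2 t (Phi u) - Phi (S1 t u) = S2 t (Phi (u - v)) - Phi (S1 t (u - v)).
  rewrite (linearB (S1 t)) (linearB Phi u v) (linearB (S2 t)) (linearB Phi)/= subrACA.
  by rewrite (intertwining_semigroup_dom graph12 t0 Dv) subrr subr0.
apply: le_lt_trans (ler_rnormB _ _) _.
have h1 : rnorm (S2 t (Phi (u - v))) <= M2 * (M * rnorm (u - v)).
  by rewrite (le_trans (S2M _))// ler_pM2l.
have h2 : rnorm (Phi (S1 t (u - v))) <= M * (M1 * rnorm (u - v)).
  by rewrite (le_trans (PhiM _))// ler_pM2l.
apply: le_lt_trans (lerD h1 h2) _.
by rewrite !mulrA -mulrDl rnormBC -ltr_pdivlMl// mulrC.
Qed.

End Intertwining.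

Theorem proposition2p2 (R : realType) (H1 H2 V1 V2 : hilbertType R)
    (j1 : {linear V1 -> H1}) (j2 : {linear V2 -> H2})
    (hj1 : dense_embedding j1) (hj2 : dense_embedding j2)
    (a1 : {sesqui V1}) (a2 : {sesqui V2})
    (ca1 : form_continuous a1) (ca2 : form_continuous a2)
    (ea1 : elliptic j1 a1) (ea2 : elliptic j2 a2)
    (S1 : R -> {linear H1 -> H1}) (S2 : R -> {linear H2 -> H2})
    (gS1 : generates (form_dom j1 a1) (fun u => - form_op j1 a1 u) S1)
    (gS2 : generates (form_dom j2 a2) (fun u => - form_op j2 a2 u) S2)
    (Phi : {linear H1 -> H2}) (cPhi : continuous Phi) :
  let cond_i := forall t : R, 0 < t -> forall u : H1,
    S2 t (Phi u) = Phi (S1 t u) in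
  let cond_ii :=
    Phi @` form_dom j1 a1 `<=` form_dom j2 a2 /\
    forall u : H1, form_dom j1 a1 u ->
      form_op j2 a2 (Phi u) = Phi (form_op j1 a1 u) in
  let cond_iii :=
    [/\ Phi @` range j1 `<=` range j2,
        adjoint Phi @` range j2 `<=` range j1 &
        forall (u : V1) (v : V2) (Phiu : V2) (Phisv : V1),
          j2 Phiu = Phi (j1 u) -> j1 Phisv = adjoint Phi (j2 v) ->
          a2 Phiu v = a1 u Phisv] in
  (cond_i <-> cond_ii) /\ (cond_iii -> cond_i /\ cond_ii).
Proof.
move=> cond_i cond_ii cond_iii.
have i_ii : cond_i -> cond_ii.
  move=> S12; split=> [_ [u Du <-]|u Du].
    by have [] := intertwining_generator cPhi gS1 gS2 S12 Du.
  by have [] := intertwining_generator cPhi gS1 gS2 S12 Du.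
have graph_i : (forall u f, form_graph j1 a1 u f -> form_graph j2 a2 (Phi u) (Phi f)) ->
    cond_i.
  move=> graph12 t t0 u.
  exact: (intertwining_semigroup hj1 hj2 cPhi gS1 gS2 ca1 ea1 ea2 graph12 t0 u).
have ii_i : cond_ii -> cond_i.
  move=> [domPhi opPhi]; apply: graph_i => u f uf.
  have Du : form_dom j1 a1 u by exists f.
  have DPhiu : form_dom j2 a2 (Phi u) by apply: domPhi; exists u.
  (* Uniqueness of the value on the graph identifies [form_op j1 a1 u] with [f]. *)
  by have := form_graph_op hj2 DPhiu; rewrite opPhi// (form_op_graph hj1 uf).
split; first by split.
move=> [PhiV adjV a12].
suff: cond_i by move=> S12; split=> //; exact: i_ii.
exact: graph_i (intertwining_form_graph cPhi PhiV adjV a12).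
Qed.
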